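(* Let $K$ be a field and let $\phi:\mathfrak g\twoheadrightarrow\mathfrak h$ be a surjective homomorphism of Lie algebras over $K$. Then the following are equivalent: (1) $\operatorname{cd}(\phi)=0$; (2) $\mathfrak h=0$; (3) $\phi$ is the zero homomorphism.
   Context: Lie algebras are over a field $K$ and may be infinite-dimensional. Modules over a Lie algebra $\mathfrak g$ are left $\mathfrak g$-modules, equivalently left modules over the universal enveloping algebra $U(\mathfrak g)$ (no finiteness assumption). $H^n(\mathfrak g,M)$ denotes Chevalley--Eilenberg cohomology (equivalently $\operatorname{Ext}^n_{U(\mathfrak g)}(K,M)$). For a Lie algebra homomorphism $\phi:\mathfrak g\to\mathfrak h$ and an $\mathfrak h$-module $M$, regarded as a $\mathfrak g$-module by restriction along $\phi$, there is an induced map $\phi^*:H^n(\mathfrak h,M)\to H^n(\mathfrak g,M)$ for each $n\ge 0$. The cohomological dimension of $\phi$ is $$\operatorname{cd}(\phi)=\sup\{n\ge 0:\ \text{there is an }\mathfrak h\text{-module }M\text{ with }\phi^*:H^n(\mathfrak h,M)\to H^n(\mathfrak g,M)\text{ nonzero}\},$$ a value in $\{0,1,2,\dots\}\cup\{\infty\}$. *)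

(* Defs.v *)
From HB Require Import structures.
From mathcomp Require Import all_boot all_order all_algebra.
From mathcomp Require Import all_classical all_reals ereal.

Set Implicit Arguments.
Unset Strict Implicit.
Unset Printing Implicit Defensive.

Import Order.TTheory GRing.Theory Num.Theory.
Local Open Scope ring_scope.
Local Open Scope quotient_scope.

HB.mixin Record isLieAlgebra (K : fieldType) (L : Type)
    of GRing.Lmodule K L := {
  lie : L -> L -> L;
  lie_linearl : forall (a : K) (x y z : L),
    lie (a *: x + y) z = a *: lie x z + lie y z;
  lie_linearr : forall (a : K) (x y z : L),
    lie z (a *: x + y) = a *: lie z x + lie z y;
  liexx : forall x : L, lie x x = 0;
  lie_jacobi : forall x y z : L,
    lie x (lie y z) + lie y (lie z x) + lie z (lie x y) = 0
}.

#[short(type="lieAlgType")]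
HB.structure Definition LieAlgebra (K : fieldType) :=
  {L of isLieAlgebra K L & GRing.Lmodule K L}.

HB.mixin Record isLieHom (K : fieldType) (g h : lieAlgType K) (f : g -> h) := {
  lie_morph : forall x y : g, f (lie x y) = lie (f x) (f y)
}.

#[short(type="lieHomType")]
HB.structure Definition LieHom (K : fieldType) (g h : lieAlgType K) :=
  {f of isLieHom K g h f & @GRing.Linear K g h *:%R f}.

HB.mixin Record isLieModule (K : fieldType) (g : lieAlgType K) (M : Type)
    of GRing.Lmodule K M := {
  lact : g -> M -> M;
  lact_linearl : forall (a : K) (x y : g) (m : M),
    lact (a *: x + y) m = a *: lact x m + lact y m;
  lact_linearr : forall (a : K) (x : g) (m n : M),
    lact x (a *: m + n) = a *: lact x m + lact x n;
  lact_lie : forall (x y : g) (m : M),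
    lact (lie x y) m = lact x (lact y m) - lact y (lact x m)
}.

#[short(type="lieModType")]
HB.structure Definition LieModule (K : fieldType) (g : lieAlgType K) :=
  {M of isLieModule K g M & GRing.Lmodule K M}.

(* The type M again, tagged by phi so that it can carry the action of g through
   phi. *)
Definition lie_restr (K : fieldType) (g h : lieAlgType K)
  (phi : lieHomType g h) (M : Type) : Type := M.

Section Restriction.
Variables (K : fieldType) (g h : lieAlgType K) (phi : lieHomType g h).
Variable M : lieModType h.

HB.instance Definition _ := GRing.Lmodule.on (lie_restr phi M).

Let ract (x : g) (m : lie_restr phi M) : lie_restr phi M :=
  lact (phi x) (m : M).

Fact ract_linearl (a : K) (x y : g) (m : lie_restr phi M) :
  ract (a *: x + y) m = a *: ract x m + ract y m.
Proof. by rewrite /ract linearP lact_linearl. Qed.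

Fact ract_linearr (a : K) (x : g) (m n : lie_restr phi M) :
  ract x (a *: m + n) = a *: ract x m + ract x n.
Proof. exact: lact_linearr. Qed.

Fact ract_lie (x y : g) (m : lie_restr phi M) :
  ract (lie x y) m = ract x (ract y m) - ract y (ract x m).
Proof. by rewrite /ract lie_morph lact_lie. Qed.

HB.instance Definition _ := isLieModule.Build K g (lie_restr phi M)
  ract_linearl ract_linearr ract_lie.

End Restriction.

Section ChevalleyEilenberg.
Variables (K : fieldType) (g : lieAlgType K) (M : lieModType g).

Definition multilinear n (f : ('I_n -> g) -> M) : Prop :=
  forall (x : 'I_n -> g) (i : 'I_n) (a : K) (u v : g),
    f [eta x with i |-> a *: u + v] =
    a *: f [eta x with i |-> u] + f [eta x with i |-> v].

Definition alternating n (f : ('I_n -> g) -> M) : Prop :=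
  forall (x : 'I_n -> g) (i j : 'I_n), i != j -> x i = x j -> f x = 0.

Definition cochain n (f : ('I_n -> g) -> M) : Prop :=
  multilinear f /\ alternating f.

(* ([x_i, x_j], x_0, .., x_n) with x_i and x_j omitted from the tail; this is
   only meaningful for i < j, where bump j (bump i l) is the l-th index of
   {0, .., n} other than i and j. *)
Definition ce_contract n (x : 'I_n.+1 -> g) (i j : 'I_n.+1) : 'I_n -> g :=
  fun k => if k == 0 :> nat then lie (x i) (x j)
           else x (inord (bump j (bump i k.-1))).

Definition ce_d n (f : ('I_n -> g) -> M) : ('I_n.+1 -> g) -> M := fun x =>
  \sum_(i < n.+1) (-1) ^+ i *: lact (x i) (f (fun k => x (lift i k)))
  + \sum_(i < n.+1) \sum_(j < n.+1 | (i < j)%N)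
      (-1) ^+ (i + j) *: f (ce_contract x i j).

Definition cocycle_pred n : {pred ('I_n -> g) -> M} :=
  fun f => `[< cochain f /\ ce_d f = 0 >].
Arguments cocycle_pred : clear implicits.

Fact ce_dP n (a : K) (f1 f2 : ('I_n -> g) -> M) :
  ce_d (a *: f1 + f2) = a *: ce_d f1 + ce_d f2.
Proof.
apply/funext => x.
change (ce_d (a *: f1 + f2) x = a *: ce_d f1 x + ce_d f2 x).
have fE y : (a *: f1 + f2) y = a *: f1 y + f2 y by [].
rewrite /ce_d scalerDr addrACA !scaler_sumr.
congr (_ + _); rewrite -big_split; apply: eq_bigr => i _ /=.
  by rewrite fE lact_linearr scalerDr !scalerA mulrC.
rewrite scaler_sumr -big_split; apply: eq_bigr => j _ /=.
by rewrite fE scalerDr !scalerA mulrC.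
Qed.

Fact cochainP n (a : K) (f1 f2 : ('I_n -> g) -> M) :
  cochain f1 -> cochain f2 -> cochain (a *: f1 + f2).
Proof.
have fE y : (a *: f1 + f2) y = a *: f1 y + f2 y by [].
move=> [l1 a1] [l2 a2]; split=> [x i b u v|x i j ij xij]; rewrite !fE.
  rewrite l1 l2 !scalerDr !scalerA addrACA [a * b]mulrC.
  by rewrite -!scalerA.
by rewrite (a1 _ _ _ ij xij) (a2 _ _ _ ij xij) scaler0 addr0.
Qed.

Fact cochain0 n : cochain (0 : ('I_n -> g) -> M).
Proof. by split=> [x i b u v|//]; rewrite [RHS]addr0 scaler0. Qed.

Fact ce_d0 n : ce_d (0 : ('I_n -> g) -> M) = 0.
Proof.
have := ce_dP (-1) (0 : ('I_n -> g) -> M) 0.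
by rewrite scaler0 addr0 scaleN1r addNr.
Qed.

Fact cocycle_submod_closed n : submod_closed (cocycle_pred n).
Proof.
split=> [|a f1 f2 /asboolP[c1 d1] /asboolP[c2 d2]]; apply/asboolP.
  by split; [exact: cochain0|exact: ce_d0].
by split; [exact: cochainP|rewrite ce_dP d1 d2 scaler0 addr0].
Qed.

HB.instance Definition _ n := GRing.isSubmodClosed.Build K _ (cocycle_pred n)
  (cocycle_submod_closed n).

Record cocycle n := Cocycle {
  cocycle_val :> ('I_n -> g) -> M;
  cocycleP : cocycle_val \in cocycle_pred n
}.

HB.instance Definition _ n := [isSub for @cocycle_val n].
HB.instance Definition _ n := [Choice of cocycle n by <:].
HB.instance Definition _ n := [SubChoice_isSubLmodule of cocycle n by <:].

Definition is_coboundary n : (('I_n -> g) -> M) -> Prop :=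
  match n with
  | 0 => fun f => f = 0
  | m.+1 => fun f => exists2 e : ('I_m -> g) -> M, cochain e & f = ce_d e
  end.

(* The cocycles of the form ce_d e, i.e. B^n as a subgroup of Z^n. *)
Definition coboundary_pred n : {pred cocycle n} :=
  fun f => `[< is_coboundary (f : ('I_n -> g) -> M) >].
Arguments coboundary_pred : clear implicits.

Fact coboundary_zmod_closed n : zmod_closed (coboundary_pred n).
Proof.
split=> [|f1 f2 b1 b2]; apply/asboolP.
  by case: n => [//|n] /=; exists 0; [exact: cochain0|rewrite ce_d0].
have -> : (f1 - f2 : cocycle n) = (f1 : ('I_n -> g) -> M) - f2
  :> (('I_n -> g) -> M) by [].
move: b1 b2 => /asboolP + /asboolP +.
case: n f1 f2 => [|n] f1 f2 /=; first by move=> -> ->; rewrite subr0.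
move=> [e1 c1 ->] [e2 c2 ->]; exists ((-1) *: e2 + e1); first exact: cochainP.
by rewrite ce_dP scaleN1r addrC.
Qed.

HB.instance Definition _ n := GRing.isZmodClosed.Build _ (coboundary_pred n)
  (coboundary_zmod_closed n).

Definition lieH n : zmodType := Quotient.quot (coboundary_pred n).

End ChevalleyEilenberg.

Arguments cocycle_pred {K g} M n.
Arguments coboundary_pred {K g} M n.
Arguments lieH {K} g M n.

Section InducedMap.
Variables (K : fieldType) (g h : lieAlgType K) (phi : lieHomType g h).
Variables (M : lieModType h) (n : nat).

Definition cochain_pull m (f : ('I_m -> h) -> M) :
  ('I_m -> g) -> lie_restr phi M := fun x => f (phi \o x).

Fact cochain_pullP m (f : ('I_m -> h) -> M) :
  cochain f -> cochain (cochain_pull f).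
Proof.
have E (x : 'I_m -> g) i u :
    phi \o [eta x with i |-> u] = [eta phi \o x with i |-> phi u].
  by apply/funext => j /=; case: ifP.
move=> [fl fa]; split=> [x i a u v|x i j ij xij]; rewrite /cochain_pull.
  by rewrite !E linearP fl.
by apply: (fa _ _ _ ij); rewrite /= xij.
Qed.

Fact ce_d_pull m (f : ('I_m -> h) -> M) :
  ce_d (cochain_pull f) = cochain_pull (ce_d f).
Proof.
apply/funext => x; rewrite /ce_d /cochain_pull; congr (_ + _).
apply: eq_bigr => i _; apply: eq_bigr => j _; congr (_ *: f _).
by apply/funext => k; rewrite /ce_contract /=; case: ifP; rewrite ?lie_morph.
Qed.

Fact cocycle_pull_subproof (c : cocycle M n) :
  cochain_pull c \in cocycle_pred (lie_restr phi M : lieModType g) n.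
Proof.
have /asboolP[cc dc] := cocycleP c; apply/asboolP.
by split; [exact: cochain_pullP|rewrite ce_d_pull dc].
Qed.

Definition cocycle_pull (c : cocycle M n) : cocycle (lie_restr phi M) n :=
  Cocycle (cocycle_pull_subproof c).

(* Defined on representatives; lieH_map_pi shows independence of the choice. *)
Definition lieH_map (c : lieH h M n) : lieH g (lie_restr phi M) n :=
  \pi_(lieH g (lie_restr phi M) n) (cocycle_pull (repr c)).

Lemma lieH_map_pi (c : cocycle M n) :
  lieH_map (\pi_(lieH h M n) c) =
  \pi_(lieH g (lie_restr phi M) n) (cocycle_pull c).
Proof.
apply/eqP; rewrite /lieH_map -Quotient.idealrBE.
have : repr (\pi_(lieH h M n) c) - c \in coboundary_pred M n.
  by rewrite Quotient.idealrBE reprK.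
move: (repr _) => b /asboolP bc; apply/asboolP.
have {bc} : is_coboundary ((b : ('I_n -> h) -> M) - c) by [].
change (is_coboundary ((b : ('I_n -> h) -> M) - c) ->
        is_coboundary (cochain_pull (b \- c))).
case: n b c => [|m] b c /=; first exact: (congr1 (@cochain_pull 0)).
move=> [e ce bc]; exists (cochain_pull e); first exact: cochain_pullP.
by rewrite ce_d_pull; exact: (congr1 (@cochain_pull m.+1) bc).
Qed.

End InducedMap.

(* The supremum is taken in the extended integers, where every set has one. *)
Definition cd (K : fieldType) (g h : lieAlgType K) (phi : lieHomType g h) :
    \bar int :=
  supremum -oo%E [set (n%:Z)%:E | n in
    [set n : nat | exists M : lieModType h,
                     exists c : lieH h M n, lieH_map phi c != 0]].

(* Main.v *)
(* Since phi is onto, it is injective on H^1, so it suffices to give, for every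
   h <> 0, an h-module M with H^1(h, M) <> 0; M is infinite-dimensional in
   general, by Whitehead's lemma. Let d be a nonzero derivation of h (inner, or
   the identity if h is abelian). Then h acts on the vector space h by the
   infinitesimal affine maps v |-> [y, v] + d y, hence on families of symmetric
   multilinear forms on h, in all degrees at once, and the form "unit", equal
   to 1 in degree 0 and to 0 in positive degrees, is invariant. If d y <> 0,
   then y . F = unit (up to sign) has a solution F, computed degree by degree by
   dividing by d y. Let M be the space of functionals on forms that kill unit. Then
   y |-> y . ev, where ev is evaluation in degree 0, is a 1-cocycle with values
   in M. It is not y |-> y . m with m in M: evaluated at F, the former gives
   ev(unit) = 1 and the latter m(unit) = 0. This avoids the
   Poincare-Birkhoff-Witt theorem and works in every characteristic. *)
Require Import Defs.
From HB Require Import structures.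
From mathcomp Require Import all_boot all_order all_algebra.
From mathcomp Require Import all_classical all_reals ereal.
From mathcomp Require Import ring.

Set Implicit Arguments.
Unset Strict Implicit.
Unset Printing Implicit Defensive.

Import Order.TTheory GRing.Theory Num.Theory.
Local Open Scope ring_scope.
Local Open Scope quotient_scope.

(** * Linear forms on arbitrary vector spaces *)

(** Zorn's lemma gives a subspace maximal among those avoiding [w]; it is a complement of the line
    [K w], and [l] reads off the coefficient of [w]. *)
Lemma ex_linear_form (K : fieldType) (V : lmodType K) (w : V) :
  w != 0 -> exists2 l : V -> K,
    (forall a u v, l (a *: u + v) = a * l u + l v) & l w = 1.
Proof.
(* Adjoining 0 by hand lets the empty set, the union of the empty chain, satisfy [P]. *)
move=> w0; pose P (H : set V) := ~ H w /\
  forall a u v, H u \/ u = 0 -> H v \/ v = 0 ->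
    H (a *: u + v) \/ a *: u + v = 0.
have [|H [[Hw Hlin] Hmax]] := @Zorn_bigcup V P.
  move=> F FP Ftot; split=> [[A FA Aw]|a u v]; first by case: (FP _ FA).
  have inF A x : F A -> A x \/ x = 0 -> (\bigcup_(X in F) X)%classic x \/ x = 0.
    by move=> FA [Ax|->]; [left; exists A|right].
  move=> [[A FA Au]|u0] [[B FB Bv]|v0].
  - have [AB|BA] := Ftot _ _ FA FB.
      by apply: (inF B) => //; apply: (FP _ FB).2; left => //; exact: AB.
    by apply: (inF A) => //; apply: (FP _ FA).2; left => //; exact: BA.
  - by apply: (inF A) => //; apply: (FP _ FA).2; [left|right].
  - by apply: (inF B) => //; apply: (FP _ FB).2; [right|left].
  - by right; rewrite u0 v0 scaler0 addr0.
pose H0 x := H x \/ x = 0.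
have H0lin a u v : H0 u -> H0 v -> H0 (a *: u + v) by exact: Hlin.
have H0w : ~ H0 w by case=> // /eqP; exact/negP.
have dec v : exists a, H0 (v - a *: w).
  have [Hv|Hv] := pselect (H v).
    by exists 0; rewrite scale0r subr0; left.
  (* If [v] is outside [H], maximality puts [w] in the span of [H] and [v]. *)
  pose B x := exists b u, H0 u /\ x = u + b *: v.
  have HB : (H `<` B)%classic.
    split=> [x Hx|BH]; first exists 0, x.
      by split; [left|rewrite scale0r addr0].
    by apply: Hv; apply: BH; exists 1, 0; split; [right|rewrite scale1r add0r].
  have B0 x : B x \/ x = 0 -> B x.
    by case=> // ->; exists 0, 0; split; [right|rewrite scale0r addr0].
  have [b [u [Hu wE]]] : B w.
    apply: contrapT => Bw; apply: (Hmax _ HB); split=> // a x y.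
    move=> /B0[b [u [Hu ->]]] /B0[b' [u' [Hu' ->]]]; left.
    exists (a * b + b'), (a *: u + u'); split; first exact: H0lin.
    by rewrite scalerDr scalerA scalerDl addrACA.
  have b0 : b != 0.
    by apply/eqP => b0; apply: H0w; rewrite wE b0 scale0r addr0.
  exists b^-1; rewrite wE scalerDr scalerA mulVf // scale1r opprD addrCA subrr.
  by rewrite addr0 -scaleNr -[X in H0 X]addr0; apply: H0lin => //; right.
have uniq a b v : H0 (v - a *: w) -> H0 (v - b *: w) -> a = b.
  move=> Ha Hb; apply/eqP/negP => /negP ab.
  have := H0lin (-1) _ _ Ha Hb.
  rewrite scaleN1r opprB addrA subrK -scalerBl => H1.
  have := H0lin (a - b)^-1 _ _ H1 (or_intror erefl).
  by rewrite addr0 scalerA mulVf ?scale1r // subr_eq0.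
have [l lP] := choice dec.
exists l => [a u v|].
  apply: (uniq _ _ _ (lP _)).
  have := H0lin a _ _ (lP u) (lP v).
  by rewrite scalerBr scalerA scalerDl opprD addrACA.
apply: (uniq _ _ _ (lP w)); rewrite scale1r subrr; by right.
Qed.

(** * Symmetric forms in all degrees and affine maps acting on them *)

Section SymmetricForms.
Variables (K : fieldType) (V : lmodType K).
Implicit Types (F G : seq V -> K) (s t : seq V) (f : V -> V).

(** One function on lists holds a form in every degree, so that contraction with a vector is
    consing; adjacent swaps generate all permutations. *)
Definition is_symform F : Prop :=
  (forall s t a u v,
     F (s ++ a *: u + v :: t) = a * F (s ++ u :: t) + F (s ++ v :: t)) /\
  (forall s t u v, F (s ++ u :: v :: t) = F (s ++ v :: u :: t)).

Definition linear_map f := forall a u v, f (a *: u + v) = a *: f u + f v.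

Lemma symform_lin F a u v t : is_symform F ->
  F (a *: u + v :: t) = a * F (u :: t) + F (v :: t).
Proof. by case=> lF _; exact: (lF [::]). Qed.

Lemma symform_swap F u v t : is_symform F -> F (u :: v :: t) = F (v :: u :: t).
Proof. by case=> _ sF; exact: (sF [::]). Qed.

Lemma symform_cons F u : is_symform F -> is_symform (fun s => F (u :: s)).
Proof.
by case=> lF sF; split=> s; [exact: (lF (u :: s))|exact: (sF (u :: s))].
Qed.

Lemma symform_add F u v t : is_symform F ->
  F (u + v :: t) = F (u :: t) + F (v :: t).
Proof. by move=> sF; have := symform_lin 1 u v t sF; rewrite scale1r mul1r. Qed.

Lemma symform0 F t : is_symform F -> F (0 :: t) = 0.
Proof.
move=> sF; have := symform_add 0 0 t sF.
by rewrite addr0 -[LHS]addr0 => /addrI.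
Qed.

Lemma symform_sub F u v t : is_symform F ->
  F (u - v :: t) = F (u :: t) - F (v :: t).
Proof.
move=> sF; rewrite addrC -scaleN1r symform_lin // mulN1r addrC //.
Qed.

Lemma is_symform_lin a F G :
  is_symform F -> is_symform G -> is_symform (fun s => a * F s + G s).
Proof.
move=> [lF sF] [lG sG]; split=> [s t b u v|s t u v].
  by rewrite lF lG !mulrDr addrACA mulrCA.
by rewrite sF sG.
Qed.

Definition form_unit s : K := (s == [::])%:R.

Lemma form_unit_symform : is_symform form_unit.
Proof. by split=> [[|? ?]|[|? ?]] * //; rewrite /form_unit mulr0 addr0. Qed.

(** Up to sign, the natural action of the endomorphism [f] on forms. *)
Fixpoint form_der f F s : K :=
  if s is v :: s' then F (f v :: s') + form_der f (fun t => F (v :: t)) s'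
  else 0.

Lemma form_der_lin f a F G H s : (forall t, H t = a * F t + G t) ->
  form_der f H s = a * form_der f F s + form_der f G s.
Proof.
elim: s F G H => [|v s IH] F G H HE /=; first by rewrite mulr0 addr0.
rewrite HE (IH _ _ _ (fun t => HE (v :: t))).
by rewrite mulrDr addrACA.
Qed.

(** [form_der] preserves the degree, so a form built degree by degree can be differentiated degree
    by degree. *)
Lemma form_der_local f F G s :
  (forall t, size t = size s -> F t = G t) -> form_der f F s = form_der f G s.
Proof.
elim: s F G => [//|v s IH] F G FG /=; rewrite FG //; congr (_ + _).
by apply: IH => t ts; rewrite FG //= ts.
Qed.

Lemma form_der_symform f F :
  linear_map f -> is_symform F -> is_symform (form_der f F).
Proof.
move=> lf sF; split=> [s t a u v|s t u v]; elim: s F sF => [|x s IH] F sF /=.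
- rewrite lf symform_lin // mulrDr addrACA; congr (_ + _).
  by apply: form_der_lin => r; exact: symform_lin.
- rewrite (proj1 (symform_cons (f x) sF)) IH; last exact: symform_cons.
  by rewrite mulrDr addrACA.
- rewrite addrA (symform_swap (f u) v) // (symform_swap u (f v)) //.
  rewrite [F _ + F _]addrC addrA.
  by congr (_ + _); apply: form_der_local => r _; exact: symform_swap.
- rewrite IH; last exact: symform_cons.
  by rewrite (proj2 (symform_cons (f x) sF)).
Qed.

(** Terms where [f] and [g] hit different arguments cancel. The order is reversed because
    precomposition is contravariant. *)
Lemma form_der_comm f g h F s : is_symform F ->
  (forall v, h v = f (g v) - g (f v)) ->
  form_der h F s = form_der g (form_der f F) s - form_der f (form_der g F) s.
Proof.
move=> sF hE; elim: s F sF => [|v s IH] F sF /=; first by rewrite subr0.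
have E (f1 f2 : V -> V) : form_der f1 (fun t => form_der f2 F (v :: t)) s =
    form_der f1 (fun t => F (f2 v :: t)) s +
    form_der f1 (form_der f2 (fun t => F (v :: t))) s.
  rewrite -[X in X + _]mul1r; apply: form_der_lin => t; by rewrite mul1r.
rewrite IH; last exact: symform_cons.
rewrite hE symform_sub //= in E *; rewrite !E.
ring.
Qed.

(* The infinitesimal affine map v |-> f v + w acting on forms. *)
Definition form_act f w F s : K := form_der f F s + F (w :: s).

Lemma form_act_symform f w F :
  linear_map f -> is_symform F -> is_symform (form_act f w F).
Proof.
move=> lf sF.
have := is_symform_lin 1 (form_der_symform lf sF) (symform_cons w sF).
by congr is_symform; apply/funext => s; rewrite mul1r.
Qed.

(** The commutator of two affine maps has linear part [h] and translation part [c]; the double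
    contractions with [a] and [b] cancel by symmetry of [F]. *)
Lemma form_act_comm f g h a b c F s : is_symform F ->
  (forall v, h v = f (g v) - g (f v)) -> c = f b - g a ->
  form_act h c F s =
  form_act g b (form_act f a F) s - form_act f a (form_act g b F) s.
Proof.
move=> sF hE cE; rewrite /form_act cE symform_sub // (form_der_comm s sF hE) /=.
have E (f1 f2 : V -> V) x :
    form_der f1 (fun t => form_der f2 F t + F (x :: t)) s =
    form_der f1 (form_der f2 F) s + form_der f1 (fun t => F (x :: t)) s.
  by rewrite -[X in X + _]mul1r; apply: form_der_lin => t; rewrite mul1r.
rewrite !E (symform_swap a b) //; ring.
Qed.

(** * Division of forms by a nonzero vector *)

Section Division.
Variables (l : V -> K) (w : V).
Hypothesis l_lin : forall a u v, l (a *: u + v) = a * l u + l v.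
Hypothesis lw : l w = 1.

Let pr v := v - l v *: w.

Let pr_lin : linear_map pr.
Proof.
by move=> a u v; rewrite /pr l_lin scalerDl -scalerA opprD addrACA scalerBr.
Qed.

Let prw : pr w = 0. Proof. by rewrite /pr lw scale1r subrr. Qed.

(* Replacing each argument v by (l v) w + pr v, this is the unique symmetric
   form whose contraction with w is G and which vanishes if
   all arguments are in ker l. *)
Fixpoint form_div G s : K :=
  if s is v :: s' then l v * G s' + form_div (fun t => G (pr v :: t)) s' else 0.

Lemma form_div_lin a F G H s : (forall t, H t = a * F t + G t) ->
  form_div H s = a * form_div F s + form_div G s.
Proof.
elim: s F G H => [|v s IH] F G H HE /=; first by rewrite mulr0 addr0.
rewrite HE (IH _ _ _ (fun t => HE (pr v :: t))).
by rewrite !mulrDr addrACA mulrCA.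
Qed.

Lemma form_div_ext F G s : F =1 G -> form_div F s = form_div G s.
Proof. by move=> /funext->. Qed.

Lemma form_div_symform G : is_symform G -> is_symform (form_div G).
Proof.
move=> sG; split=> [s t a u v|s t u v]; elim: s G sG => [|x s IH] G sG /=.
- rewrite l_lin mulrDl !mulrDr addrACA -mulrA; congr (_ + _).
  by apply: form_div_lin => r; rewrite pr_lin symform_lin.
- rewrite (proj1 sG) IH; last exact: symform_cons.
  by rewrite !mulrDr addrACA mulrCA.
(* By [E], the two leading terms sum to l u G(v) + l v G(u) - l u l v G(w), which is symmetric in u
   and v. *)
- have E x r : G (pr x :: r) = G (x :: r) - l x * G (w :: r).
    by rewrite symform_sub // -[l x *: w]addr0 symform_lin // symform0 // addr0.
  rewrite !E.
  rewrite (@form_div_ext (fun r => G (pr u :: pr v :: r))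
                     (fun r => G (pr v :: pr u :: r))); last first.
    by move=> r; exact: symform_swap.
  ring.
- rewrite IH; last exact: symform_cons.
  by rewrite (proj2 sG).
Qed.

Lemma form_divK G s : is_symform G -> form_div G (w :: s) = G s.
Proof.
move=> sG /=; rewrite lw mul1r prw.
(* A function equal to -1 times itself plus itself is sent to 0 by any linear operator. *)
have G0 t : G (0 :: t) = -1 * G (0 :: t) + G (0 :: t).
  by rewrite !symform0 // mulr0 addr0.
by rewrite (form_div_lin s G0) mulN1r addNr addr0.
Qed.

Variable f : V -> V.
Hypothesis f_lin : linear_map f.

(** Iteration for F = [form_div] (unit - [form_der f] F). Division raises the degree by one, so the
    n-th iterate is exact in degrees up to n. *)
Fixpoint unit_approx n : seq V -> K :=
  if n is n'.+1 then
    form_div (fun s => (-1) * form_der f (unit_approx n') s + form_unit s)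
  else fun=> 0.

Lemma unit_approx_symform n : is_symform (unit_approx n).
Proof.
elim: n => [|n IH] /=; first by split=> * //; rewrite mulr0 addr0.
apply: form_div_symform; apply: is_symform_lin; last exact: form_unit_symform.
exact: form_der_symform.
Qed.

Lemma form_act_onto_unit :
  exists2 F, is_symform F & form_act f w F = form_unit.
Proof.
exists (fun s => unit_approx (size s) s).
  split=> [s t a u v|s t u v].
    by rewrite !size_cat /= (proj1 (unit_approx_symform _)).
  by rewrite !size_cat /= (proj2 (unit_approx_symform _)).
(* Consing [w] raises the degree by one and so unfolds one step of the recursion; the two derivative
   terms then cancel. *)
apply/funext => s; rewrite /form_act [size (w :: s)]/= /unit_approx.
rewrite -/unit_approx form_divK; last first.
  apply: is_symform_lin; last exact: form_unit_symform.
  exact: form_der_symform f_lin (unit_approx_symform _).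
rewrite (@form_der_local f _ (unit_approx (size s))) => [|t -> //].
by rewrite mulN1r addNKr.
Qed.

End Division.

Lemma ex_form_act_unit f w : linear_map f -> w != 0 ->
  exists2 F, is_symform F & form_act f w F = form_unit.
Proof.
by move=> lf /ex_linear_form[l ll lw]; exact: form_act_onto_unit ll lw _ lf.
Qed.

End SymmetricForms.

(** * Nonzero derivations of a Lie algebra *)

Record symform (K : fieldType) (V : lmodType K) := SymForm {
  symform_val :> seq V -> K;
  symformP : is_symform symform_val
}.

(** The Leibniz rule is written as the 1-cocycle condition for the adjoint module, the form matching
    the translation part in [form_act_comm]. *)
Record derivation (K : fieldType) (h : lieAlgType K) := Derivation {
  der_val :> h -> h;
  der_lin : linear_map der_val;
  der_lie : forall x y,
    der_val (lie x y) = lie x (der_val y) - lie y (der_val x)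
}.

Section LieBracket.
Variables (K : fieldType) (h : lieAlgType K).
Implicit Types x y z : h.

Lemma lieDr x y z : lie x (y + z) = lie x y + lie x z.
Proof. by have := lie_linearr 1 y z x; rewrite !scale1r. Qed.

Lemma lieDl x y z : lie (x + y) z = lie x z + lie y z.
Proof. by have := lie_linearl 1 x y z; rewrite !scale1r. Qed.

Lemma lieC x y : lie x y = - lie y x.
Proof.
apply/eqP; rewrite -addr_eq0; apply/eqP.
by have := liexx (x + y); rewrite lieDl !lieDr !liexx addr0 add0r.
Qed.

Lemma lie_lin x : linear_map (lie x).
Proof. by move=> a u v; rewrite lie_linearr. Qed.

Lemma lieNr x y : lie x (- y) = - lie x y.
Proof.
have lie0 : lie x 0 = 0 :> h by apply: (addrI (lie x 0)); rewrite -lieDr !addr0.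
by have := lie_linearr (-1) y 0 x; rewrite lie0 !addr0 !scaleN1r.
Qed.

Lemma lie_jacobi_act x y z :
  lie (lie x y) z = lie x (lie y z) - lie y (lie x z).
Proof.
rewrite lieC; apply/esym/eqP.
by rewrite -addr_eq0 [lie x z]lieC lieNr opprK lie_jacobi.
Qed.

Lemma ex_derivation (p : h) : p != 0 ->
  exists d : derivation h, exists y, d y != 0.
Proof.
move=> p0; have [[z [y zy]]|ab] := pselect (exists z y : h, lie z y != 0).
  have dl : linear_map (fun v : h => lie v y).
    by move=> a u v; rewrite lie_linearl.
  have dd u v : lie (lie u v) y = lie u (lie v y) - lie v (lie u y).
    exact: lie_jacobi_act.
  by exists (Derivation dl dd), z.
have lie0 x y : lie x y = 0.
  by apply/eqP/negP => /negP xy; apply: ab; exists x, y.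
have dd x y : lie x y = lie x y - lie y x by rewrite !lie0 subr0.
by exists (Derivation (der_val := id) (fun a u v => erefl) dd), p.
Qed.

End LieBracket.

(** * The module of functionals killing the unit form *)

Section DualModule.
Variables (K : fieldType) (h : lieAlgType K) (d : derivation h).

Definition form_op (y : h) (F : symform h) : symform h :=
  SymForm (form_act_symform (d y) (lie_lin y) (symformP F)).

Definition unit_form : symform h := SymForm (@form_unit_symform K h).

Lemma symform_eq (F G : symform h) : F =1 G -> F = G.
Proof.
case: F G => [F FP] [G GP] /= /funext FG; subst G; congr SymForm.
exact: Prop_irrelevance.
Qed.

(** Affine vector fields kill constants; hence the functionals vanishing on [unit_form] are stable
    under [h]. *)
Lemma form_op_unit (y : h) s : form_op y unit_form s = 0.
Proof.
rewrite /= /form_act [form_unit (_ :: _)]/= addr0.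
case: s => //= v s; rewrite /form_unit add0r.
by elim: s => //= *; rewrite add0r.
Qed.

Definition functional_pred : {pred symform h -> K^o} := fun m =>
  `[< (forall a (F G H : symform h), (forall s, H s = a * F s + G s) ->
         m H = a * m F + m G) /\ m unit_form = 0 >].

Fact functional_submod_closed : submod_closed functional_pred.
Proof.
split=> [|a m n /asboolP[lm m1] /asboolP[ln n1]]; apply/asboolP; split=> //.
- by move=> *; rewrite /= mulr0 addr0.
- move=> b F G H HE.
  change (a * m H + n H = b * (a * m F + n F) + (a * m G + n G)).
  by rewrite (lm _ _ _ _ HE) (ln _ _ _ _ HE); ring.
- by change (a * m unit_form + n unit_form = 0); rewrite m1 n1 mulr0 addr0.
Qed.

HB.instance Definition _ := GRing.isSubmodClosed.Build K _ functional_pred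
  functional_submod_closed.

Record functional := Functional {
  functional_val :> symform h -> K^o;
  functionalP : functional_val \in functional_pred
}.

HB.instance Definition _ := [isSub for functional_val].
HB.instance Definition _ := [Choice of functional by <:].
HB.instance Definition _ := [SubChoice_isSubLmodule of functional by <:].

(* The tag d carries the action of h by affine vector fields. *)
Definition affine_dual (_ : derivation h) : Type := functional.

HB.instance Definition _ := GRing.Lmodule.on (affine_dual d).

Lemma functional_lin (m : functional) a (F G H : symform h) :
  (forall s, H s = a * F s + G s) -> m H = a * m F + m G.
Proof. by have /asboolP[] := functionalP m; auto. Qed.

Lemma functional_zero (m : functional) (F : symform h) :
  (forall s, F s = 0) -> m F = 0.
Proof.
move=> F0; have /= := functional_lin m (a := -1) (F := F) (G := F) (H := F).
by rewrite mulN1r addNr; apply=> s; rewrite !F0 mulr0 addr0.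
Qed.

Fact functional_act_subproof y (m : affine_dual d) :
  (fun F => m (form_op y F)) \in functional_pred.
Proof.
apply/asboolP; split=> [a F G H HE|]; last first.
  exact/functional_zero/form_op_unit.
apply: functional_lin => s; rewrite /= /form_act HE (form_der_lin _ _ HE).
by rewrite mulrDr addrACA.
Qed.

Definition functional_act y m : affine_dual d :=
  Functional (functional_act_subproof y m).

Fact functional_act_linearl (a : K) (x y : h) (m : affine_dual d) :
  functional_act (a *: x + y) m = a *: functional_act x m + functional_act y m.
Proof.
apply/val_inj/funext => F.
change (m (form_op (a *: x + y) F) = a * m (form_op x F) + m (form_op y F)).
apply: functional_lin => s; rewrite /= /form_act.
rewrite der_lin symform_lin ?mulrDr 1?addrACA; last exact: symformP.
congr (_ + _); elim: s (symform_val F) (symformP F) => [|v s IH] G sG /=.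
  by rewrite mulr0 addr0.
rewrite lie_linearl symform_lin // IH; last exact: symform_cons.
by rewrite mulrDr addrACA.
Qed.

Fact functional_act_linearr (a : K) (x : h) (m n : affine_dual d) :
  functional_act x (a *: m + n) = a *: functional_act x m + functional_act x n.
Proof. exact/val_inj. Qed.

(** Dualizing reverses products again, undoing the reversal in [form_act_comm], so this is a left
    action without a sign. *)
Fact functional_act_lie (x y : h) (m : affine_dual d) :
  functional_act (lie x y) m =
  functional_act x (functional_act y m) - functional_act y (functional_act x m).
Proof.
apply/val_inj/funext => F.
change (m (form_op (lie x y) F) =
        m (form_op y (form_op x F)) - m (form_op x (form_op y F))).
rewrite addrC -mulN1r; apply: functional_lin => s.
rewrite mulN1r addrC; apply: form_act_comm; first exact: symformP.
  by move=> v; exact: lie_jacobi_act.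
exact: der_lie.
Qed.

HB.instance Definition _ := isLieModule.Build K h (affine_dual d)
  functional_act_linearl functional_act_linearr functional_act_lie.

Fact der_functional_subproof (y : h) :
  (fun F : symform h => F [:: d y] : K^o) \in functional_pred.
Proof. by apply/asboolP; split=> [a F G H ->|]. Qed.

(** This is y . ev: in degree 0, [form_op y F] is [F [:: d y]]. *)
Definition der_functional y : affine_dual d :=
  Functional (der_functional_subproof y).

Lemma der_functional_lin (a : K) (x y : h) :
  der_functional (a *: x + y) = a *: der_functional x + der_functional y.
Proof.
apply/val_inj/funext => F.
change (F [:: d (a *: x + y)] = a * F [:: d x] + F [:: d y]).
by rewrite der_lin symform_lin //; exact: symformP.
Qed.

Lemma der_functional_lie (x y : h) :
  der_functional (lie x y) =
  lact x (der_functional y) - lact y (der_functional x).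
Proof.
apply/val_inj/funext => F.
(* Each 0 is the derivative over the empty tail; the terms of degree two cancel by symmetry. *)
change (F [:: d (lie x y)] =
  (F [:: lie x (d y)] + 0 + F [:: d x; d y]) -
  (F [:: lie y (d x)] + 0 + F [:: d y; d x])).
rewrite der_lie symform_sub; last exact: symformP.
rewrite (symform_swap (d x)); last exact: symformP.
ring.
Qed.

Lemma der_functional_neq_act (y : h) (m : affine_dual d) :
  d y != 0 -> der_functional y <> lact y m.
Proof.
move=> /(ex_form_act_unit (lie_lin y))[F sF Fy] /(congr1 val).
move=> /(congr1 (fun n => n (SymForm sF))).
change (F [:: d y] = m (form_op y (SymForm sF)) -> False).
have -> : form_op y (SymForm sF) = unit_form.
  by apply: symform_eq => s /=; rewrite Fy.
have /asboolP[_ ->] := functionalP m.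
(* In degree 0, y . F = unit reads [F [:: d y] = 1]. *)
have := congr1 (@^~ [::]) Fy; rewrite /form_act /= add0r /form_unit /= => ->.
by move/eqP; rewrite oner_eq0.
Qed.

End DualModule.

(** * Coboundaries in low degrees *)

Lemma lieH_pi_eq0 (K : fieldType) (g : lieAlgType K) (M : lieModType g) n
    (c : cocycle M n) :
  \pi_(lieH g M n) c = 0 <-> is_coboundary (c : ('I_n -> g) -> M).
Proof.
rewrite -[0](raddf0 (\pi_(lieH g M n))).
split=> [/eqP|cb]; last apply/eqP.
  by rewrite -Quotient.idealrBE subr0 => /asboolP.
by rewrite -Quotient.idealrBE subr0; apply/asboolP.
Qed.

Lemma ce_d0E (K : fieldType) (g : lieAlgType K) (M : lieModType g)
    (f : ('I_0 -> g) -> M) x :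
  ce_d f x = lact (x ord0) (f (fun k => x (lift ord0 k))).
Proof.
rewrite /ce_d !big_ord_recl !big_ord0 big_mkcond big_ord_recl big_ord0 /=.
by rewrite scale1r !addr0.
Qed.

Lemma ce_d1E (K : fieldType) (g : lieAlgType K) (M : lieModType g)
    (f : ('I_1 -> g) -> M) x :
  ce_d f x = lact (x ord0) (f (fun=> x ord_max))
             - lact (x ord_max) (f (fun=> x ord0))
             - f (fun=> lie (x ord0) (x ord_max)).
Proof.
rewrite /ce_d !big_ord_recl !big_ord0.
rewrite big_mkcond !big_ord_recl big_ord0 big_mkcond !big_ord_recl big_ord0 /=.
have l0 : lift ord0 ord0 = ord_max :> 'I_2 by exact/val_inj.
have fE (y y' : 'I_1 -> g) : y ord0 = y' ord0 -> f y = f y'.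
  by move=> yy'; congr f; apply/funext => k; rewrite ord1.
rewrite l0 /= scale1r !scaleN1r !addr0 add0r.
congr (lact _ _ - lact _ _ - _); apply: fE; rewrite ?l0 //.
by congr x; exact/val_inj.
Qed.

(** * A class in degree one that survives pullback *)

Section FirstCohomology.
Variables (K : fieldType) (h : lieAlgType K) (d : derivation h).

Definition der_cochain (x : 'I_1 -> h) : affine_dual d :=
  der_functional d (x ord0).

Fact der_cocycle_subproof :
  der_cochain \in cocycle_pred (affine_dual d : lieModType h) 1.
Proof.
apply/asboolP; split.
  split=> [x i a u v|x i j]; last by rewrite !ord1.
  by rewrite [i]ord1 /der_cochain /= der_functional_lin.
apply/funext => x; rewrite ce_d1E /der_cochain der_functional_lie.
exact: subrr.
Qed.

Definition der_cocycle : cocycle (affine_dual d : lieModType h) 1 :=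
  Cocycle der_cocycle_subproof.

(** A 0-cochain is a single vector m, and its coboundary at [x] is phi x . m, which
    [der_functional_neq_act] excludes. *)
Lemma lieH_map_der_cocycle (g : lieAlgType K) (phi : lieHomType g h) (x : g) :
  d (phi x) != 0 ->
  lieH_map phi (\pi_(lieH h (affine_dual d : lieModType h) 1) der_cocycle) != 0.
Proof.
move=> dx; rewrite lieH_map_pi; apply/eqP => /lieH_pi_eq0[e _].
move=> /(congr1 (@^~ (fun=> x))); rewrite ce_d0E.
exact: der_functional_neq_act.
Qed.

End FirstCohomology.

(** * Degree zero: trivial coefficients *)

Definition trivial_mod (K : fieldType) (h : lieAlgType K) : Type := K^o.

Section TrivialModule.
Variables (K : fieldType) (h : lieAlgType K).

HB.instance Definition _ := GRing.Lmodule.on (trivial_mod h).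

Let tact (x : h) (m : trivial_mod h) : trivial_mod h := 0.

Fact tact_linearl (a : K) (x y : h) m :
  tact (a *: x + y) m = a *: tact x m + tact y m.
Proof. by rewrite /tact scaler0 addr0. Qed.

Fact tact_linearr (a : K) (x : h) m n :
  tact x (a *: m + n) = a *: tact x m + tact x n.
Proof. by rewrite /tact scaler0 addr0. Qed.

Fact tact_lie (x y : h) m :
  tact (lie x y) m = tact x (tact y m) - tact y (tact x m).
Proof. by rewrite /tact subr0. Qed.

HB.instance Definition _ := isLieModule.Build K h (trivial_mod h)
  tact_linearl tact_linearr tact_lie.

Fact one_cocycle_subproof :
  (fun=> 1 : K^o) \in cocycle_pred (trivial_mod h : lieModType h) 0.
Proof.
apply/asboolP; split; first by split=> ? [].
by apply/funext => x; rewrite ce_d0E.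
Qed.

(** The constant 1 pulls back to the constant 1, and the only coboundary in degree 0 is 0. *)
Lemma lieH_map0_neq0 (g : lieAlgType K) (phi : lieHomType g h) :
  exists M : lieModType h, exists c : lieH h M 0, lieH_map phi c != 0.
Proof.
exists (trivial_mod h : lieModType h).
exists (\pi_(lieH h (trivial_mod h : lieModType h) 0)
  (Cocycle one_cocycle_subproof)).
rewrite lieH_map_pi; apply/eqP => /lieH_pi_eq0 /(congr1 (@^~ (fun=> 0))) /eqP.
by apply/negP; exact: oner_neq0.
Qed.

End TrivialModule.

(** * Computation of the cohomological dimension *)

Lemma lieH_map_eq0 (K : fieldType) (g h : lieAlgType K) (phi : lieHomType g h)
    (M : lieModType h) n (c : lieH h M n.+1) :
  (forall y : h, y = 0) -> lieH_map phi c = 0.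
Proof.
move=> h0; apply/lieH_pi_eq0; exists 0; first exact: cochain0.
rewrite ce_d0; apply/funext => x.
change ((repr c : cocycle M n.+1) (phi \o x) = 0).
have /asboolP[[lc _] _] := cocycleP (repr c).
(* Linearity in the first slot at 0 = 1 *: 0 + 0 shows that the value equals twice itself. *)
have := lc (phi \o x) ord0 1 0 0; rewrite scale1r addr0 scale1r.
set y := [eta _ with _ |-> _].
rewrite (_ : phi \o x = y); last first.
  by apply/funext => i; exact: etrans (h0 _) (esym (h0 _)).
by rewrite -[X in X = _]addr0 => /addrI.
Qed.

(** [supremum] returns [x0] by default, so a value other than [x0] is a genuine least upper
    bound. *)
Lemma supremum_ubound (d : Order.disp_t) (T : porderType d) (x0 x : T)
    (A : set T) :
  A x -> supremum x0 A != x0 -> (x <= supremum x0 A)%O.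
Proof.
move=> Ax; have [[_ [u uA]]|/supremum_out->] := pselect (has_sup A); last first.
  by rewrite eqxx.
rewrite /supremum; case: ifP => [/eqP A0|_]; first by rewrite A0 in Ax.
by case: xgetP => [y -> [yA _] _|_]; [exact: yA|rewrite eqxx].
Qed.

Theorem theorem4p4 (K : fieldType) (g h : lieAlgType K) (phi : lieHomType g h)
    (phi_surj : forall y : h, exists x : g, phi x = y) :
  (cd phi = 0%E <-> (forall y : h, y = 0)) /\
  ((forall y : h, y = 0) <-> (forall x : g, phi x = 0)).
Proof.
split; last first.
  by split=> [h0 x|phi0 y]; [exact: h0|have [x <-] := phi_surj y].
split=> [cd0 p|h0].
  apply/eqP/negP => /negP /ex_derivation[d [y dy]].
  have [x xy] := phi_surj y; subst y.
  (* The value 0 is not the default -oo, so it bounds the set; but the set contains 1. *)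
  have /(@supremum_ubound _ _ -oo%E) :
      [set (n%:Z)%:E | n in [set n : nat | exists M : lieModType h,
        exists c : lieH h M n, lieH_map phi c != 0]]%classic (1%:Z)%:E.
    exists 1%N => //; exists (affine_dual d : lieModType h); eexists.
    exact: lieH_map_der_cocycle dy.
  by rewrite -/(cd phi) cd0 => /(_ isT).
(* For [h] = 0 the set of degrees is exactly {0}. *)
rewrite /cd -[RHS](supremum1 -oo%E); congr supremum.
apply/seteqP; split=> [_ [n nP <-]|_ ->] /=; last first.
  by exists 0%N => //; exact: lieH_map0_neq0.
case: n nP => // n [M [c]].
by rewrite lieH_map_eq0 ?eqxx.
Qed.
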